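(* Let $C$ be an absolute constant with the following property: for every $n\ge1$, all i.i.d. real random variables $Z_1,\ldots,Z_n$ with a non-degenerate log-concave density symmetric about $0$, and all $\alpha,\beta\in\mathbb{R}^n$ with $\alpha\ne0$, one has $\mathbf{P}\{|\langle\alpha,Z\rangle|\le|\langle\beta,Z\rangle|\}\le C\|\beta\|/\|\alpha\|$. Let $X_1,\ldots,X_n$ be i.i.d. with a symmetric (about $0$) unimodal density $f$ such that, for some $B$, $$\int_{\mathbb{R}}t^2f(t)\,dt\le B\quad\text{and}\quad\int_0^1 t^{-3}\big[\mathbf{P}\{|X_1|\le t\}-2tf(t)\big]\,dt\le B.$$ Then for all $\alpha,\beta\in\mathbb{R}^n$ with $\alpha\neq0$, $$\mathbf{P}\{|\langle\alpha,X\rangle|\le|\langle\beta,X\rangle|\}\le 12\,C\,B\,\frac{\|\beta\|}{\|\alpha\|}.$$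
   Context: For a random vector $W=(W_1,\ldots,W_n)$ and $\alpha\in\mathbb{R}^n$, $\langle\alpha,W\rangle=\sum_{i=1}^n\alpha_iW_i$; $\|\cdot\|$ is the Euclidean norm. A density is log-concave if it is of the form $e^{-g}$ with $g$ convex, taking values in $(-\infty,+\infty]$. A density symmetric about $0$ is unimodal if it is non-increasing on $[0,\infty)$. An absolute constant $C$ with the stated property exists. *)

(* Defs.v *)
From HB Require Import structures.
From mathcomp Require Import all_boot all_order all_algebra.
From mathcomp Require Import all_classical all_reals all_analysis.

Set Implicit Arguments.
Unset Strict Implicit.
Unset Printing Implicit Defensive.

Import Order.TTheory GRing.Theory Num.Theory.
Import numFieldNormedType.Exports.

Local Open Scope classical_set_scope.
Local Open Scope ring_scope.

(* The library norm on 'rV[R]_n is the sup norm, hence this definition. *)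
Definition euclidean_norm (R : realType) (n : nat) (a : 'rV[R]_n) : R :=
  Num.sqrt (\sum_(i < n) a 0 i ^+ 2).

Section RandomVectors.
Context d (T : measurableType d) (R : realType) (P : probability T R).

Definition inner (n : nat) (a : 'rV[R]_n) (W : 'I_n -> {RV P >-> R}) (w : T) : R :=
  \sum_(i < n) a 0 i * W i w.

Definition mutually_independent (n : nat) (W : 'I_n -> {RV P >-> R}) : Prop :=
  forall (J : {set 'I_n}) (A : 'I_n -> set R),
    (forall i, measurable (A i)) ->
    (P (\bigcap_(i in [set` J]) (W i @^-1` A i)) =
     \prod_(i in J) P (W i @^-1` A i))%E.

Definition has_density (W : {RV P >-> R}) (f : R -> R) : Prop :=
  [/\ measurable_fun setT f,
      forall x, 0 <= f x &
      forall A : set R, measurable A ->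
        distribution P W A = (\int[lebesgue_measure]_(x in A) (f x)%:E)%E].

(* The laws coincide since each is the one with density f. *)
Definition iid_with_density (n : nat) (W : 'I_n -> {RV P >-> R}) (f : R -> R) : Prop :=
  mutually_independent W /\ forall i, has_density (W i) f.

Definition nondegenerate (W : {RV P >-> R}) : Prop :=
  ~ exists c : R, P [set w | W w = c] = 1%E.

End RandomVectors.

Definition symmetric_density (R : realType) (f : R -> R) : Prop :=
  forall x, f (- x) = f x.

(* Convexity of a function with values in (-oo, +oo]; the library's
   convex_function only covers real values. *)
Definition ext_convex (R : realType) (g : R -> \bar R) : Prop :=
  (forall x, g x != -oo%E) /\
  forall (x y t : R), 0 < t < 1 ->
    (g (t * x + (1 - t) * y)%R <= t%:E * g x + (1 - t)%:E * g y)%E.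

Definition log_concave (R : realType) (f : R -> R) : Prop :=
  exists g : R -> \bar R,
    ext_convex g /\ forall x, (f x)%:E = expeR (- g x)%E.

Definition symmetric_unimodal (R : realType) (f : R -> R) : Prop :=
  symmetric_density f /\ forall x y, 0 <= x -> x <= y -> f y <= f x.

Definition log_concave_constant (R : realType) (C : R) : Prop :=
  forall (n : nat), (0 < n)%N ->
  forall (d : measure_display) (T : measurableType d) (P : probability T R)
         (Z : 'I_n -> {RV P >-> R}) (f : R -> R),
    iid_with_density Z f -> (forall i, nondegenerate (Z i)) ->
    log_concave f -> symmetric_density f ->
  forall alpha beta : 'rV[R]_n, alpha != 0 ->
    (P [set w | `|inner alpha Z w| <= `|inner beta Z w| ]%R <=
     (C * (euclidean_norm beta / euclidean_norm alpha))%:E)%E.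

(* Main.v *)
Require Import Defs.
From HB Require Import structures.
From mathcomp Require Import all_boot all_order all_algebra.
From mathcomp Require Import all_classical all_reals all_analysis.
From mathcomp Require Import measurable_realfun ring lra.

(** A symmetric unimodal density is a mixture of uniform densities on intervals
    centred at 0. Writing f x as the length of {s | 0 < s < f x}, a variable X
    with density f is obtained by drawing a height s with density 2 r(s), where
    2 r(s) is the Lebesgue measure of the level set {f > s}, and then drawing X
    uniformly on that level set, which is the interval [- r(s), r(s)] up to a
    null set.

    Apply this to every coordinate. Given radii rho_i, the variables X_i / rho_i
    are independent and uniform on [-1, 1], a law that is log-concave, so the
    hypothesis on C bounds the conditional probability by
      C |(beta_i rho_i)| / |(alpha_i rho_i)|.
    By Jensen and the inequality of arithmetic and geometric means
    ([euclidean_ratio_le]) this is at most a combination of the rho_i ^ 2 and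
    the rho_i ^ -2, in which each coordinate appears separately. Its expectation
    then involves only E (r ^ 2) = 3 E (X ^ 2) <= 3 B
    ([integral_level_radius_sqr]) and E (r ^ -2) <= 2 B + 1
    ([integral_level_radius_inv_sqr]); the latter is what the second hypothesis
    on f says, since for almost every t the probability that the radius is
    smaller than t is P (|X| <= t) - 2 t f(t). The resulting bound is
    C (5 B + 1) / 2 times the ratio of the norms, and r ^ 2 + r ^ -2 >= 2 forces
    5 B >= 1, so it is below 12 C B.

    The conditioning takes place on the given probability space: once the height
    s of coordinate k is fixed, the conditional law is P reweighted by a function
    of X_k ([condition_on_level]), and the original P is the mixture of these
    laws over s ([probability_level_mixture]). The coordinates are conditioned
    one at a time ([uniform_mixture_bound]); since the bound is a sum of one term
    per coordinate, each step integrates over a single height. *)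

Set Implicit Arguments.
Unset Strict Implicit.
Unset Printing Implicit Defensive.

Import Order.TTheory GRing.Theory Num.Theory.
Import numFieldNormedType.Exports.

Local Open Scope classical_set_scope.
Local Open Scope ring_scope.

(** * Layer-cake integration *)

(** The bound 0 < s makes the level sets empty for s <= 0, so that integrals over
    heights can be taken over the whole line. *)
Definition level (T : Type) (R : realType) (g : T -> R) (s : R) : set T :=
  [set x | 0 < s < g x].

Section layer_cake.
Context d (T : measurableType d) (R : realType).
Variables (mu : {sigma_finite_measure set T -> \bar R}).
Variables (g : T -> R) (mg : measurable_fun setT g) (g0 : forall x, 0 <= g x).

Let below_graph : set (T * R) := [set z | 0 < z.2 < g z.1].

Let measurable_below_graph : measurable below_graph.
Proof.
rewrite -[below_graph]setTI.
have : measurable_fun setT (fun z : T * R => (0 < z.2) && (z.2 < g z.1)).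
  apply: measurable_and.
    by apply: measurable_fun_ltr => //; exact: measurable_snd.
  apply: measurable_fun_ltr; first exact: measurable_snd.
  exact: measurableT_comp.
by move=> /(_ measurableT [set true]); apply.
Qed.

Lemma measurable_level s : measurable (level g s).
Proof.
rewrite -[level g s]setTI.
have : measurable_fun setT (fun x : T => (0 < s) && (s < g x)).
  by apply: measurable_and => //; exact: measurable_fun_ltr.
by move=> /(_ measurableT [set true]); apply.
Qed.

Variables (k : T -> \bar R) (mk : measurable_fun setT k).
Hypothesis k0 : forall x, (0 <= k x)%E.

Let K (z : T * R) : \bar R := (k z.1 * (\1_below_graph z)%:E)%E.

Let measurable_K : measurable_fun setT K.
Proof.
apply: emeasurable_funM; first by apply: measurableT_comp.
by apply/measurable_EFinP; exact: measurable_indic.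
Qed.

Let K_ge0 z : (0 <= K z)%E.
Proof. by rewrite mule_ge0// lee_fin. Qed.

Let level_sliceE s :
  (\int[mu]_(x in level g s) k x = \int[mu]_x K (x, s))%E.
Proof.
rewrite integral_mkcond; apply: eq_integral => x _.
rewrite epatch_indic /K/= !indicE.
by congr (_ * _%:R%:E)%E; congr nat_of_bool; apply/idP/idP; rewrite !inE.
Qed.

Lemma measurable_level_integral :
  measurable_fun setT (fun s => \int[mu]_(x in level g s) k x)%E.
Proof.
under eq_fun do rewrite level_sliceE.
exact: (measurable_fun_fubini_tonelli_G K).
Qed.

(** Both sides integrate k over the region below the graph of g; this is
    Tonelli's theorem, the weight k being arbitrary. *)
Lemma layer_cake :
  (\int[mu]_x ((g x)%:E * k x) =
   \int[lebesgue_measure]_s \int[mu]_(x in level g s) k x)%E.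
Proof.
under [RHS]eq_integral do rewrite level_sliceE.
rewrite -(@fubini_tonelli _ _ _ _ _ mu lebesgue_measure K)//; apply: eq_integral => x _.
transitivity (\int[lebesgue_measure]_s (k x * (\1_(`]0%R, g x[%classic : set R) s)%:E))%E; last first.
  apply: eq_integral => s _; rewrite /K/= !indicE; congr (_ * _%:R%:E)%E.
have mI : measurable_fun [set: measurableTypeR R]
    (fun s => (\1_(`]0%R, g x[%classic : set R) s)%:E : \bar R).
  by apply/measurable_EFinP; exact: measurable_indic.
rewrite ge0_integralZl//.
rewrite integral_indic// setIT/= lebesgue_measure_itv/= lte_fin muleC.
congr (_ * _)%E; rewrite EFinN sube0; case: ltP => // gx0.
by congr EFin; apply/le_anti; rewrite g0 gx0.
Qed.

End layer_cake.

(** With D independent of X, c = P D and f the density of X, this computes the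
    integral over D of a function of X. By the layer-cake formula it is enough
    to know the measure of D together with each event that X lies in a level set
    of g, which is the hypothesis. *)
Lemma integral_independent_density d (T : measurableType d) (R : realType)
    (P : {sigma_finite_measure set T -> \bar R}) (X : {mfun T >-> R}) (D : set T)
    (c : R) (f g : R -> R) :
  measurable D -> 0 <= c ->
  measurable_fun setT f -> (forall x, 0 <= f x) ->
  (forall A, measurable A ->
    P (D `&` X @^-1` A) = c%:E * \int[lebesgue_measure]_(x in A) (f x)%:E)%E ->
  measurable_fun setT g -> (forall x, 0 <= g x) ->
  (\int[P]_(w in D) (g (X w))%:E =
   c%:E * \int[lebesgue_measure]_x (g x * f x)%:E)%E.
Proof.
move=> mD c0 mf f0 lawD mg g0.
have mfE : measurable_fun [set: measurableTypeR R] (EFin \o f).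
  exact/measurable_EFinP.
transitivity (\int[P]_w ((g (X w))%:E * (\1_D w)%:E))%E.
  rewrite integral_mkcond; apply: eq_integral => w _.
  by rewrite epatch_indic.
rewrite (@layer_cake _ _ _ P (g \o X) _ _ (EFin \o \1_D))//; last first.
- by move=> w; rewrite lee_fin.
- by apply/measurable_EFinP; exact: measurable_indic.
- by move=> w; exact: g0.
- exact: measurableT_comp.
transitivity (c%:E * \int[lebesgue_measure]_s
    \int[lebesgue_measure]_(x in level g s) (EFin \o f) x)%E.
  rewrite -ge0_integralZl//; last 2 first.
  - exact: measurable_level_integral.
  - by move=> s _; apply: integral_ge0 => x _; rewrite lee_fin.
  apply: eq_integral => s _; have mL := measurable_level mg s.
  rewrite integral_indic//; last exact: measurable_level (measurableT_comp _ _) _.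
  exact: lawD.
by congr (_ * _)%E; rewrite -layer_cake.
Qed.

(** Lebesgue measure is the only measure with the right value on intervals, and
    its rescaled image has that value. *)
Lemma lebesgue_measure_div (R : realType) (rho : R) (A : set R) :
  0 < rho -> measurable A ->
  (lebesgue_measure [set x | A (x / rho)%R] = rho%:E * lebesgue_measure A)%E.
Proof.
move=> rho0 mA.
have rhoV0 : 0 <= rho^-1 by rewrite invr_ge0 ltW.
suff <- : mscale (NngNum rhoV0) (pushforward lebesgue_measure
    ((fun x => x / rho) : R -> measurableTypeR R)) A = lebesgue_measure A.
- exact: measurable_funM.
- by move=> mdiv; rewrite /mscale/= /pushforward muleA -EFinM mulfV ?mul1e// gt_eqF.
move=> mdiv; apply/esym/lebesgue_measure_unique => //.
move=> _ [[a b] _ <-] /=; rewrite /mscale/= /pushforward/=.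
have -> : (fun x : R => x / rho) @^-1` [set` `]a, b] ] =
    [set` `](rho * a), (rho * b)]].
  apply/seteqP; split=> x /=; rewrite !in_itv/= ltr_pdivlMr// ler_pdivrMr//;
  by rewrite (mulrC a) (mulrC b).
rewrite !lebesgue_measure_itv/= !lte_fin ltr_pM2l//.
case: ifPn => _; last by rewrite mule0.
by rewrite -EFinM -mulrBr mulrA mulVf ?mul1r// gt_eqF.
Qed.

(** * Two elementary integrals *)

(** Inversion is continuous away from 0, and a singleton does not affect
    measurability. *)
Lemma measurable_inv (R : realType) : measurable_fun [set: R] (@GRing.inv R).
Proof.
rewrite -(setUv [set 0]); apply/measurable_funU => //; first exact: measurableC.
split; first exact: measurable_fun_set1.
apply: open_continuous_measurable_fun.
  by apply: closed_openC; exact: closed_eq.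
by move=> x; rewrite inE/= => /eqP x0; exact: inv_continuous.
Qed.

Lemma integral_is_derive (R : realType) (f F : R -> R) (a b : R) : a < b ->
  (forall x, a <= x <= b -> is_derive x 1 F (f x)) ->
  (forall x, a <= x <= b -> {for x, continuous f}) ->
  (\int[lebesgue_measure]_(x in `[a, b]) (f x)%:E = (F b - F a)%:E)%E.
Proof.
move=> ab dF cf.
have cF x : a <= x <= b -> {for x, continuous F}.
  move=> /dF [dFx _]; apply: differentiable_continuous.
  exact/derivable1_diffP.
rewrite (@continuous_FTC2 _ f F)//.
- by apply: continuous_in_subspaceT => x; rewrite inE/= in_itv/=; exact: cf.
- split.
  + move=> x; rewrite in_itv/= => /andP[ax xb].
    by have [] := dF x; rewrite ?(ltW ax)// ltW.
  + by apply: cvg_at_right_filter; apply: cF; rewrite lexx ltW.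
  + by apply: cvg_at_left_filter; apply: cF; rewrite lexx ltW.
- move=> x; rewrite in_itv/= => /andP[ax xb].
  rewrite derive1E; have [] := dF x; last by [].
  by rewrite (ltW ax) ltW.
Qed.

Lemma integral_sqr_sym (R : realType) (r : R) : 0 <= r ->
  (\int[lebesgue_measure]_(x in `[(- r)%R, r]) (x ^+ 2)%:E = (2 * r ^+ 3 / 3)%:E)%E.
Proof.
rewrite le_eqVlt => /predU1P[<-|r0].
  by rewrite oppr0 set_itv1 integral_set1 expr0n/= mulr0 mul0r.
transitivity ((3^-1 * r ^+ 3 - 3^-1 * (- r) ^+ 3)%:E : \bar R); last first.
  by congr EFin; field.
apply: (@integral_is_derive _ _ (fun x => 3^-1 * x ^+ 3)).
- by rewrite gtrN.
- move=> x _; apply: is_derive_eq; rewrite /GRing.scale/=.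
  by field.
- move=> x _; exact: exprn_continuous.
Qed.

Lemma integral_inv_cube (R : realType) (r : R) : 0 < r -> r < 1 ->
  (\int[lebesgue_measure]_(x in `[r, 1%R]) (x ^- 3)%:E = ((r ^- 2 - 1) / 2)%:E)%E.
Proof.
move=> r0 r1.
transitivity ((- 2^-1 * (1 ^+ 2)^-1 - - 2^-1 * (r ^+ 2)^-1)%:E : \bar R); last first.
  by congr EFin; field; rewrite gt_eqF.
apply: (@integral_is_derive _ _ (fun x => - 2^-1 * (x ^+ 2)^-1)) => //.
- move=> x /andP[rx _].
  have x0 : x != 0 by rewrite gt_eqF// (lt_le_trans r0).
  have x20 : x ^+ 2 != 0 by rewrite expf_neq0.
  have dsqr : is_derive x 1 (fun y : R => y ^+ 2) (2 * x).
    by apply: is_derive_eq; rewrite /GRing.scale/=; ring.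
  have dinv := @is_deriveV _ (fun y => y ^+ 2) x _ 1 x20 dsqr.
  apply: is_derive_eq.
  by rewrite /GRing.scale/=; field.
- move=> x /andP[rx _]; have x0 : x != 0 by rewrite gt_eqF// (lt_le_trans r0).
  apply: cvgV; first by rewrite expf_neq0.
  exact: exprn_continuous.
Qed.

(** * Level sets of a symmetric unimodal density *)

Definition level_radius (R : realType) (f : R -> R) (s : R) : R :=
  fine (lebesgue_measure (level f s)) / 2.

Section level_radius.
Context (R : realType).
Local Notation mu := (@lebesgue_measure R).
Variables (f : R -> R).
Hypothesis mf : measurable_fun setT f.
Hypothesis f0 : forall x, 0 <= f x.
Hypothesis f1 : (\int[mu]_x (f x)%:E = 1)%E.
Hypothesis hf : symmetric_unimodal f.
Local Notation rad := (level_radius f).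

Lemma level_radius_ge0 s : 0 <= rad s.
Proof. by rewrite divr_ge0// fine_ge0// measure_ge0. Qed.

(** Level sets of positive height have finite measure by Markov's inequality, so
    no information is lost in [fine]. *)
Lemma level_measureE s : mu (level f s) = (2 * rad s)%:E.
Proof.
have mL := measurable_level mf s.
suff fin : (mu (level f s) < +oo)%E.
  by rewrite /level_radius mulrCA mulfV// mulr1 fineK// ge0_fin_numE.
have [s0|s0] := leP s 0.
  have -> : level f s = set0.
    by rewrite -subset0 => x /=; rewrite /level/= (le_gtF s0).
  by rewrite measure0 ltry.
have : (s%:E * mu (level f s) <= 1)%E.
  rewrite -integral_cst// -f1.
  apply: (@le_trans _ _ (\int[mu]_(x in level f s) (f x)%:E)%E).
    apply: ge0_le_integral => //.
    - by move=> x _; rewrite lee_fin ltW.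
    - by apply/measurable_EFinP/measurable_funTS.
    - by move=> x /= /andP[_ /ltW]; rewrite lee_fin.
  apply: ge0_subset_integral => //; first exact/measurable_EFinP.
  by move=> x _; rewrite lee_fin.
move=> le1; rewrite ltNge; apply/negP; rewrite leye_eq => /eqP Loo.
by move: le1; rewrite Loo gt0_muley ?lte_fin.
Qed.

Lemma measurable_level_radius : measurable_fun [set: R] rad.
Proof.
apply: measurable_funM => //; apply: measurableT_comp => //.
have := @measurable_level_integral _ _ _ mu f mf (cst 1%E) (measurable_cst _) (fun=> lee01).
apply: eq_measurable_fun => s _ /=.
by rewrite integral_cst ?mul1e//; exact: measurable_level.
Qed.

Lemma level_itv x y s : level f s x -> `|y| <= `|x| -> level f s y.
Proof.
have fE z : f `|z| = f z by case: (ger0P z) => // _; rewrite hf.1.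
rewrite /level/= -(fE x) -(fE y) => /andP[-> sx] yx /=.
by rewrite (lt_le_trans sx)// hf.2.
Qed.

(** If x has height above s then so has all of [-|x|, |x|]; comparing measures,
    2 |x| is at most the measure of the level set. *)
Lemma level_sub s : level f s `<=` `[- rad s, rad s].
Proof.
move=> x Lx /=; rewrite in_itv/= -ler_norml.
have sub : `[- `|x|, `|x|] `<=` level f s.
  by move=> y /=; rewrite in_itv/= -ler_norml; exact: level_itv.
have : (mu `[(- `|x|)%R, `|x|%R] <= mu (level f s))%E.
  by apply: le_measure => //; rewrite inE//; exact: measurable_level.
rewrite level_measureE lebesgue_measure_itv/= lte_fin.
have [->|x0] := eqVneq x 0; first by rewrite normr0 level_radius_ge0.
by rewrite gtrN ?normr_gt0// -EFinD lee_fin opprK; lra.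
Qed.

Lemma level_radius_itv_null s : mu (`[- rad s, rad s] `\` level f s) = 0%E.
Proof.
have mL := measurable_level mf s.
have r0 := level_radius_ge0 s.
rewrite measureD//; last first.
  rewrite /= lebesgue_measure_itv/=; case: ifPn => _; last by rewrite ltry.
  by rewrite -EFinD ltry.
rewrite (setIidr (@level_sub s))/= level_measureE lebesgue_measure_itv/= lte_fin.
move: r0; rewrite le_eqVlt => /predU1P[<-|r0].
  by rewrite oppr0 ltxx mulr0 subee.
by rewrite gtrN// -!EFinD -[RHS]/(0%:E); congr EFin; lra.
Qed.

(** A level set lies in the closed interval with the same measure, so the two
    differ by a null set, at most the two end points. *)
Lemma integral_level s (h : R -> \bar R) :
  measurable_fun setT h -> (forall x, 0 <= h x)%E ->
  (\int[mu]_(x in level f s) h x = \int[mu]_(x in `[(- rad s)%R, rad s]) h x)%E.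
Proof.
move=> mh h0; have mL := measurable_level mf s.
have {1}-> : level f s = `[- rad s, rad s] `\` (`[- rad s, rad s] `\` level f s).
  by rewrite setDD (setIidr (@level_sub s)).
apply/esym/ge0_negligible_integral => //.
- exact: measurableD.
- exact: measurable_funTS.
- exact: level_radius_itv_null.
Qed.

(** The function 2 r(s) is a probability density on the heights. *)
Lemma integral_level_radius : (\int[mu]_s (2 * rad s)%:E = 1)%E.
Proof.
rewrite -f1; under [RHS]eq_integral do rewrite -[(f _)%:E]mule1.
rewrite layer_cake//; apply: eq_integral => s _.
have mL := measurable_level mf s.
by rewrite integral_cst// mul1e; exact/esym/level_measureE.
Qed.

(** The uniform law on [-r, r] has second moment r ^ 2 / 3. *)
Lemma integral_level_radius_sqr :
  (\int[mu]_s (2 * rad s * rad s ^+ 2)%:E = 3%:E * \int[mu]_t (t ^+ 2 * f t)%:E)%E.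
Proof.
have msqr : measurable_fun [set: R] (fun t : R => (t ^+ 2)%:E).
  by apply/measurable_EFinP; exact: measurable_funX.
under [in RHS]eq_integral do rewrite mulrC EFinM.
rewrite layer_cake//; last by move=> x; rewrite lee_fin sqr_ge0.
rewrite -ge0_integralZl//; last 2 first.
- by apply: measurable_level_integral => //  x; rewrite lee_fin sqr_ge0.
- by move=> s _; apply: integral_ge0 => x _; rewrite lee_fin sqr_ge0.
apply: eq_integral => s _.
rewrite integral_level//; last by move=> x; rewrite lee_fin sqr_ge0.
rewrite integral_sqr_sym ?level_radius_ge0// -EFinM; congr EFin.
by field.
Qed.

Variables (B : R).
Hypothesis hB3 : (\int[mu]_(t in `]0%R, 1%R])
   ((t ^- 3)%:E * (\int[mu]_(x in `[(- t)%R, t]) (f x)%:E - (2 * t * f t)%:E))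
   <= B%:E)%E.

(** The probability that the radius of the level set is smaller than t. *)
Let small_mass (t : R) : \bar R :=
  (\int[mu]_s (if (rad s < t)%R then 2 * rad s else 0)%:E)%E.

Let measurable_small (t : R) : measurable_fun [set: measurableTypeR R]
  (fun s => (if rad s < t then 2 * rad s else 0)%:E : \bar R).
Proof.
apply/measurable_EFinP; apply: measurable_fun_ifT => //.
  by apply: measurable_fun_ltr => //; exact: measurable_level_radius.
by apply: measurable_funM => //; exact: measurable_level_radius.
Qed.

Let small_ge0 t s : 0 <= (if rad s < t then 2 * rad s else 0).
Proof. by case: ifP => // _; rewrite mulr_ge0// level_radius_ge0. Qed.

(** The mass of [-t, t] is the integral over heights s of the length of the part
    of {f > s} in [-t, t]. This length is 2 t for s < f t; when the radius is
    smaller than t, the height s is at least f t and the length is the whole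
    2 r(s). *)
Lemma small_mass_le t : 0 < t ->
  (small_mass t <= \int[mu]_(x in `[(- t)%R, t]) (f x)%:E - (2 * t * f t)%:E)%E.
Proof.
move=> t0; rewrite leeBrDr//.
pose I : set R := `]0, f t[%classic.
have mIset : measurable I by exact: measurable_itv.
have mI : measurable_fun [set: measurableTypeR R]
    (fun s => (2 * t * \1_I s)%:E : \bar R).
  by apply/measurable_EFinP; apply: measurable_funM => //; exact: measurable_indic.
have -> : (2 * t * f t)%:E = (\int[mu]_s (2 * t * \1_I s)%:E)%E.
  under eq_integral do rewrite EFinM.
  rewrite ge0_integralZl//; last by rewrite lee_fin mulr_ge0// ltW.
    rewrite integral_indic// setIT/= lebesgue_measure_itv/= lte_fin EFinM.
    congr (_ * _)%E; case: ltP => [_|ft0]; first by rewrite sube0.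
    by congr EFin; apply/le_anti; rewrite f0 ft0.
  by apply/measurable_EFinP; exact: measurable_indic.
rewrite /small_mass -ge0_integralD//; last 2 first.
- by move=> s _; rewrite lee_fin.
- by move=> s _; rewrite lee_fin !mulr_ge0// ltW.
pose J : set R := `[- t, t]%classic.
have mJset : measurable J by exact: measurable_itv.
have -> : (\int[mu]_(x in `[(- t)%R, t]) (f x)%:E =
    \int[mu]_x ((f x)%:E * (\1_J x)%:E))%E.
  by rewrite integral_mkcond; apply: eq_integral => x _; rewrite epatch_indic.
have mJ : measurable_fun [set: R] (fun x => (\1_J x)%:E : \bar R).
  by apply/measurable_EFinP; exact: measurable_indic.
rewrite layer_cake//.
apply: ge0_le_integral => //.
- by move=> s _; rewrite adde_ge0 ?lee_fin// !mulr_ge0// ltW.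
- exact: emeasurable_funD.
- by apply: measurable_level_integral => // x; rewrite lee_fin.
move=> s _; have mL := measurable_level mf s.
rewrite integral_indic// -EFinD indicE.
have [Lst|nLst] := pselect (level f s t).
  rewrite (_ : s \in I); last by rewrite inE /I/= in_itv.
  have JL : J `<=` level f s.
    move=> x; rewrite /J/= in_itv/= -ler_norml => xt.
    by apply: level_itv Lst _; rewrite (ger0_norm (ltW t0)).
  rewrite (setIidl JL)/= lebesgue_measure_itv/= lte_fin gtrN// -EFinD lee_fin.
  have := level_sub Lst; rewrite /= in_itv/= => /andP[_ /le_gtF ->].
  lra.
rewrite (_ : (s \in I) = false); last first.
  by apply/negP; rewrite inE /I/= in_itv.
rewrite mulr0 addr0; case: ifPn => rt; last exact: measure_ge0.
rewrite setIidr; first by rewrite /= level_measureE.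
move=> x /level_sub; rewrite /J/= !in_itv/= => /andP[a b].
apply/andP; split; lra.
Qed.

(** Integrating H over s gives the integrand t ^ -3 * small_mass t on ]0, 1];
    integrating it over t gives r(s) (r(s) ^ -2 - 1) when 0 < r(s) < 1. *)
Let H (z : R * R) : R :=
  if (0 < z.1 <= 1) && (rad z.2 < z.1) then z.1 ^- 3 * (2 * rad z.2) else 0.

Let measurable_H : measurable_fun [set: measurableTypeR R * measurableTypeR R] H.
Proof.
have mr2 : measurable_fun [set: measurableTypeR R * measurableTypeR R]
    (fun z => rad z.2).
  by apply: measurableT_comp; [exact: measurable_level_radius|exact: measurable_snd].
have m1 : measurable_fun [set: measurableTypeR R * measurableTypeR R] (fun z => z.1).
  exact: measurable_fst.
apply: measurable_fun_ifT => //.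
  apply: measurable_and; last exact: measurable_fun_ltr.
  by apply: measurable_and; [exact: measurable_fun_ltr|exact: measurable_fun_ler].
apply: measurable_funM; last exact: measurable_funM.
by apply: measurableT_comp; [exact: measurable_inv|exact: measurable_funX].
Qed.

Let H_ge0 z : 0 <= H z.
Proof.
rewrite /H; case: ifP => // /andP[/andP[z0 _] _].
by rewrite mulr_ge0// ?invr_ge0 ?exprn_ge0 ?(ltW z0)// mulr_ge0// level_radius_ge0.
Qed.

Let measurable_mass_in (D : set R) : measurable D ->
  measurable_fun D (fun t => \int[mu]_(x in `[(- t)%R, t]) (f x)%:E)%E.
Proof.
move=> mD; pose G (t : R) : R := fine (\int[mu]_(x in `[(- t)%R, t]) (f x)%:E)%E.
have mfE : measurable_fun [set: R] (EFin \o f) by exact/measurable_EFinP.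
have Gfin t : (\int[mu]_(x in `[(- t)%R, t]) (f x)%:E)%E \is a fin_num.
  rewrite ge0_fin_numE; last by apply: integral_ge0 => x _; rewrite lee_fin.
  apply: (@le_lt_trans _ _ 1%E); last exact: ltry.
  rewrite -f1; apply: ge0_subset_integral => //.
  by move=> x _; rewrite lee_fin.
have : measurable_fun D G.
  apply: nondecreasing_measurable => // s t st; rewrite fine_le//.
  apply: ge0_subset_integral => //.
  - exact: measurable_funTS.
  - by move=> x _; rewrite lee_fin.
  - move=> x /=; rewrite !in_itv/= => /andP[a b]; apply/andP; split; lra.
move/measurable_EFinP; apply: eq_measurable_fun => t _ /=.
by rewrite /G fineK.
Qed.

Let integral_H_le : (\int[mu]_s \int[mu]_t (H (t, s))%:E <= B%:E)%E.
Proof.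
have mHE : measurable_fun [set: measurableTypeR R * measurableTypeR R] (EFin \o H).
  exact/measurable_EFinP.
rewrite -(@fubini_tonelli _ _ _ _ _ mu mu (EFin \o H))//.
apply: le_trans hB3.
have HE t : (\int[mu]_s (H (t, s))%:E =
    if (0 < t <= 1)%R then (t ^- 3)%:E * small_mass t else 0)%E.
  case: ifPn => [t01|/negbTE t01]; last first.
    by apply: integral0_eq => s _; rewrite /H/= t01.
  have t0 : 0 <= t ^- 3 by rewrite invr_ge0 exprn_ge0//; case/andP: t01 => /ltW.
  rewrite -ge0_integralZl//; last by move=> s _; rewrite lee_fin.
  apply: eq_integral => s _.
  by rewrite /H/= t01/= -EFinM; case: ifP => //; rewrite mulr0.
under eq_integral do rewrite /= HE.
rewrite [leRHS]integral_mkcond.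
apply: ge0_le_integral => //.
- move=> t _; case: ifP => // /andP[t0 _]; rewrite mule_ge0//.
    by rewrite lee_fin invr_ge0 exprn_ge0// ltW.
  by apply: integral_ge0 => s _; rewrite lee_fin.
- have := @measurable_fun_fubini_tonelli_F _ _ _ _ _ mu (EFin \o H) mHE.
  move/(_ (fun z => H_ge0 z)); apply: eq_measurable_fun => t _.
  by rewrite /fubini_F/= HE.
- apply/(measurable_restrictT _ _).1 => //; apply: emeasurable_funM.
    apply/measurable_EFinP/measurable_funTS.
    by apply: measurableT_comp; [exact: measurable_inv|exact: measurable_funX].
  apply: emeasurable_funB; first exact: measurable_mass_in.
  apply/measurable_EFinP/measurable_funTS.
  by apply: measurable_funM => //; exact: measurable_funM.
- move=> t _; rewrite patchE mem_setE in_itv/=; case: ifPn => // /andP[t0 _].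
  rewrite lee_wpmul2l ?small_mass_le// lee_fin invr_ge0 exprn_ge0// ltW//.
Qed.

Let integral_H_ge s :
  ((2 * rad s * rad s ^- 2)%:E <=
   (2 * rad s)%:E + 2%:E * \int[mu]_t (H (t, s))%:E)%E.
Proof.
have int0 : (0 <= \int[mu]_t (H (t, s))%:E)%E.
  by apply: integral_ge0 => t _; rewrite lee_fin.
have [r1|r1] := leP 1 (rad s).
  (* A radius of at least 1 contributes nothing to the integral of H, but then
     r ^ -2 <= 1. *)
  apply: (@le_trans _ _ (2 * rad s)%:E); last by rewrite leeDl// mule_ge0.
  have r20 : 0 <= 2 * rad s by rewrite mulr_ge0// level_radius_ge0.
  by rewrite lee_fin ler_piMr// invf_le1 ?exprn_ege1// exprn_gt0// (lt_le_trans _ r1).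
have := level_radius_ge0 s; rewrite le_eqVlt => /predU1P[r0|r0].
  by rewrite -r0 mulr0 mul0r adde_ge0// mule_ge0.
have -> : (\int[mu]_t (H (t, s))%:E = ((2 * rad s) * ((rad s ^- 2 - 1) / 2))%:E)%E.
  rewrite EFinM -integral_inv_cube// -integral_itv_obnd_cbnd; last first.
    apply/measurable_EFinP/measurable_funTS.
    by apply: measurableT_comp; [exact: measurable_inv|exact: measurable_funX].
  rewrite -ge0_integralZl//=.
  - rewrite [RHS]integral_mkcond; apply: eq_integral => t _.
    rewrite patchE /H/= mem_setE in_itv/=.
    have [rt|tr] := ltP (rad s) t.
      rewrite (lt_trans r0 rt)/= andbT; case: ifP => _ //=.
      by rewrite -EFinM mulrC.
    by rewrite andbF.
  - by apply/measurable_EFinP/measurable_funTS; apply: measurableT_comp;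
      [exact: measurable_inv|exact: measurable_funX].
  - move=> t /=; rewrite in_itv/= => /andP[rt _].
    by rewrite lee_fin invr_ge0 exprn_ge0// ltW// (lt_trans r0).
  - by rewrite lee_fin mulr_ge0// ltW.
by rewrite -EFinM -EFinD lee_fin; lra.
Qed.

Lemma integral_level_radius_inv_sqr :
  (\int[mu]_s (2 * rad s * rad s ^- 2)%:E <= (2 * B + 1)%:E)%E.
Proof.
have m2rad : measurable_fun [set: R] (fun s => 2 * rad s).
  by apply: measurable_funM => //; exact: measurable_level_radius.
have m2r : measurable_fun [set: measurableTypeR R] (fun s => (2 * rad s)%:E : \bar R).
  exact/measurable_EFinP.
have mH : measurable_fun [set: measurableTypeR R]
    (fun s => \int[mu]_t (H (t, s))%:E)%E.
  apply: (@measurable_fun_fubini_tonelli_G _ _ _ _ _ mu (EFin \o H)).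
  - exact/measurable_EFinP.
  - by move=> z; rewrite lee_fin.
have intH0 s : (0 <= \int[mu]_t (H (t, s))%:E)%E.
  by apply: integral_ge0 => t _; rewrite lee_fin.
have r20 s : (0 <= (2 * rad s)%:E)%E by rewrite lee_fin mulr_ge0// level_radius_ge0.
apply: (@le_trans _ _ (\int[mu]_s ((2 * rad s)%:E + 2%:E * \int[mu]_t (H (t, s))%:E))%E).
  apply: ge0_le_integral => //.
  - move=> s _.
    by rewrite EFinM mule_ge0// lee_fin invr_ge0 exprn_ge0// level_radius_ge0.
  - apply/measurable_EFinP; apply: measurable_funM => //.
    apply: measurableT_comp; first exact: measurable_inv.
    by apply: measurable_funX; exact: measurable_level_radius.
  - by apply: emeasurable_funD => //; exact: emeasurable_funM.
rewrite ge0_integralD//; last 2 first.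
- by move=> s _; rewrite mule_ge0.
- exact: emeasurable_funM.
rewrite ge0_integralZl// integral_level_radius [leRHS]EFinD [leRHS]addeC leeD//.
by rewrite EFinM; apply: lee_wpmul2l; rewrite ?lee_fin.
Qed.

End level_radius.

(** * Conditioning one coordinate on the height of its level set *)

Section weighted_probability.
Context d (T : measurableType d) (R : realType) (P : probability T R).
Variable h : T -> R.
Hypothesis mh : measurable_fun setT h.
Hypothesis h0 : forall w, 0 <= h w.
Hypothesis h1 : (\int[P]_w (h w)%:E = 1)%E.

Let weighted (A : set T) : \bar R := (\int[P]_(w in A) (h w)%:E)%E.

Let weighted0 : weighted set0 = 0%E.
Proof. exact: integral_set0. Qed.

Let weighted_ge0 A : (0 <= weighted A)%E.
Proof. by apply: integral_ge0 => w _; rewrite lee_fin. Qed.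

Let weighted_sigma_additive : semi_sigma_additive weighted.
Proof.
move=> /= F mF tF mUF; rewrite /weighted; apply: cvg_toP.
  apply: ereal_nondecreasing_is_cvgn => m n mn.
  by apply: lee_sum_nneg_natr => // k _ _; exact: weighted_ge0.
rewrite ge0_integral_bigcup//=.
- by apply/measurable_EFinP; exact: measurable_funTS.
- by move=> w _; rewrite lee_fin.
Qed.

HB.instance Definition _ := isMeasure.Build _ _ _ weighted
  weighted0 weighted_ge0 weighted_sigma_additive.

HB.instance Definition _ := @Measure_isProbability.Build _ _ R weighted h1.

Lemma weighted_probability : exists Q : probability T R,
  forall A, Q A = (\int[P]_(w in A) (h w)%:E)%E.
Proof. by exists weighted. Qed.

End weighted_probability.

Section condition_on_level.
Context d (T : measurableType d) (R : realType) (P : probability T R).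
Variables (X : {RV P >-> R}) (f : R -> R) (s : R).
Hypothesis (fX : has_density X f) (hf : symmetric_unimodal f).
Local Notation r := (level_radius f s).
Hypothesis r_gt0 : 0 < r.

Let f_meas : measurable_fun setT f. Proof. by case: fX. Qed.
Let f_ge0 x : 0 <= f x. Proof. by case: fX. Qed.

Lemma has_density_integral1 : (\int[lebesgue_measure]_x (f x)%:E = 1)%E.
Proof. by case: fX => _ _ <-//; rewrite probability_setT. Qed.

(** The conditional density of X given the height s, uniform on the level set,
    divided by the density f of X. *)
Definition level_weight (x : R) : R := \1_(level f s) x * (2 * r * f x)^-1.

Lemma level_weight_ge0 x : 0 <= level_weight x.
Proof. by rewrite mulr_ge0// invr_ge0 mulr_ge0// mulr_ge0// ltW. Qed.

Lemma measurable_level_weight : measurable_fun setT level_weight.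
Proof.
apply: measurable_funM.
  by apply: measurable_indic; exact: measurable_level.
by apply: measurableT_comp; [exact: measurable_inv|exact: measurable_funM].
Qed.

(** Reweighting P turns the law of X into the uniform law on [-r, r] and leaves
    the probability of events independent of X unchanged. *)
Lemma integral_level_weight (D : set T) (c : R) (A : set R) :
  measurable D -> 0 <= c -> measurable A ->
  (forall A', measurable A' -> P (D `&` X @^-1` A') = c%:E * P (X @^-1` A'))%E ->
  (\int[P]_(w in D `&` X @^-1` A) (level_weight (X w))%:E =
   c%:E * \int[lebesgue_measure]_(x in A) (uniform_pdf (- r) r x)%:E)%E.
Proof.
move=> mD c0 mA indep.
have mL := measurable_level f_meas s.
transitivity (\int[P]_(w in D) (\1_A (X w) * level_weight (X w))%:E)%E.
  rewrite integral_mkcondr; apply: eq_integral => w _.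
  rewrite patchE indicE/=.
  have -> : (X w \in A) = (w \in X @^-1` A) by apply/idP/idP; rewrite !inE.
  case: ifPn => _.
    by rewrite mul1r.
  by rewrite mul0r.
rewrite (@integral_independent_density _ _ _ P X D c f
  (fun x => \1_A x * level_weight x))//; last 3 first.
- by move=> A' mA'; apply: (etrans (indep _ mA')); case: fX => _ _ <-.
- apply: measurable_funM; last exact: measurable_level_weight.
  exact: measurable_indic.
- by move=> x; rewrite mulr_ge0// level_weight_ge0.
congr (_ * _)%E.
transitivity (\int[lebesgue_measure]_(x in level f s) ((2 * r)^-1 * \1_A x)%:E)%E.
  rewrite [RHS]integral_mkcond; apply: eq_integral => x _.
  rewrite patchE /level_weight !indicE; case: ifPn => [|_].
    move=> Lx; rewrite mul1r; congr EFin.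
    have fx0 : f x != 0.
      by move: Lx; rewrite inE => /andP[s0 sx]; rewrite gt_eqF// (lt_trans s0).
    have r0 : r != 0 by rewrite gt_eqF.
    by field; rewrite fx0 r0.
  by rewrite mul0r mulr0 mul0r.
rewrite integral_level//; last 3 first.
- exact: has_density_integral1.
- apply/measurable_EFinP; apply: measurable_funM => //; exact: measurable_indic.
- by move=> x; rewrite lee_fin mulr_ge0// invr_ge0 mulr_ge0// ltW.
rewrite [LHS]integral_mkcond [RHS]integral_mkcond; apply: eq_integral => x _.
rewrite !patchE /uniform_pdf mem_setE in_itv/= indicE opprK.
have -> : r + r = 2 * r by lra.
by case: ifPn => _; case: ifPn => _ //; rewrite ?mulr1 ?mulr0.
Qed.

End condition_on_level.

Lemma bigcap_preimage_setU1 (T : Type) (R : realType) (n : nat)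
    (X : 'I_n -> T -> R) (A : 'I_n -> set R) (k : 'I_n) (J : {set 'I_n}) :
  \bigcap_(i in [set` (k |: J)%SET]) (X i @^-1` A i) =
  (\bigcap_(i in [set` J]) (X i @^-1` A i)) `&` X k @^-1` A k.
Proof.
apply/seteqP; split=> w /=.
  move=> h; split; last by apply: h; rewrite /= setU11.
  by move=> i /= iJ; apply: h; rewrite /= in_setU1 iJ orbT.
by case=> hJ hk i /=; rewrite in_setU1 => /predU1P[->//|]; exact: hJ.
Qed.

Section condition_coordinate.
Context d (T : measurableType d) (R : realType) (P : probability T R).
Context (n : nat) (X : 'I_n -> {RV P >-> R}).

Lemma measurable_RV_preimage i (A : set R) :
  measurable A -> measurable (X i @^-1` A).
Proof. by move=> mA; rewrite -[X in measurable X]setTI; exact: measurable_funP. Qed.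

Lemma measurable_bigcap_preimage (A : 'I_n -> set R) (J : {set 'I_n}) :
  (forall i, measurable (A i)) ->
  measurable (\bigcap_(i in [set` J]) (X i @^-1` A i)).
Proof.
move=> mA; apply: fin_bigcap_measurable => // i _.
exact: measurable_RV_preimage.
Qed.

Hypothesis indX : mutually_independent X.

(** This is mutual independence for the family of events in which A' replaces the k-th event. *)
Lemma independent_of_others (A : 'I_n -> set R) (J : {set 'I_n}) k :
  (forall i, measurable (A i)) -> k \notin J ->
  forall A', measurable A' ->
  (P (\bigcap_(i in [set` J]) (X i @^-1` A i) `&` X k @^-1` A') =
   P (\bigcap_(i in [set` J]) (X i @^-1` A i)) * P (X k @^-1` A'))%E.
Proof.
move=> mA kJ A' mA'.
pose A2 i := if i == k then A' else A i.
have mA2 i : measurable (A2 i) by rewrite /A2; case: ifP.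
have A2k : A2 k = A' by rewrite /A2 eqxx.
have A2J i : i \in J -> A2 i = A i.
  by rewrite /A2; case: eqP => // ->; rewrite (negbTE kJ).
have -> : \bigcap_(i in [set` J]) (X i @^-1` A i) =
          \bigcap_(i in [set` J]) (X i @^-1` A2 i).
  by apply: eq_bigcapr => i /= /A2J ->.
rewrite -{1}A2k -bigcap_preimage_setU1 !indX// big_setU1//= A2k muleC.
by [].
Qed.

Variables (k : 'I_n) (f : R -> R) (s : R).
Hypothesis (fX : has_density (X k) f) (hf : symmetric_unimodal f).
Local Notation r := (level_radius f s).
Hypothesis r_gt0 : 0 < r.

(** Q is the conditional law given that the height drawn for coordinate k is s.
    Its last property expresses the contribution of the height s to P E in
    [probability_level_mixture]. *)
Lemma condition_on_level : exists Q : probability T R,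
  [/\ mutually_independent (X : 'I_n -> {RV Q >-> R}),
      forall i, i != k -> forall A, measurable A -> Q (X i @^-1` A) = P (X i @^-1` A),
      has_density (X k : {RV Q >-> R}) (uniform_pdf (- r) r) &
      forall E, measurable E ->
        (\int[P]_(w in level (f \o X k) s) ((f (X k w))^-1 * \1_E w)%:E =
         (2 * r)%:E * Q E)%E].
Proof.
have rr : - r < r by rewrite gtrN.
have mw := measurable_level_weight s fX.
have w0 := level_weight_ge0 fX r_gt0.
have unif1 : (\int[lebesgue_measure]_x (uniform_pdf (- r) r x)%:E = 1)%E.
  by rewrite integral_uniform_pdf1.
have unifP : (\int[P]_w (level_weight f s (X k w))%:E = 1)%E.
  rewrite -[RHS]unif1 -[RHS]mul1e.
  rewrite -(@integral_level_weight _ _ _ P (X k) f s fX hf r_gt0 setT 1 setT)//.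
    by rewrite preimage_setT setTI.
  by move=> A mA; rewrite setTI mul1e.
have mwX : measurable_fun setT (fun w => level_weight f s (X k w)).
  exact: measurableT_comp.
have [Q QE] := weighted_probability mwX (fun w => w0 (X k w)) unifP.
have Qlaw (A : 'I_n -> set R) (J : {set 'I_n}) (A' : set R) :
    (forall i, measurable (A i)) -> measurable A' -> k \notin J ->
  (Q (\bigcap_(i in [set` J]) (X i @^-1` A i) `&` X k @^-1` A') =
   P (\bigcap_(i in [set` J]) (X i @^-1` A i)) *
   \int[lebesgue_measure]_(x in A') (uniform_pdf (- r) r x)%:E)%E.
  move=> mA mA' kJ; have mD := measurable_bigcap_preimage J mA.
  rewrite QE; have PDE := fineK (fin_num_measure P _ mD); rewrite -PDE.
  apply: integral_level_weight => //; first by rewrite fine_ge0.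
  by move=> A2 mA2; rewrite independent_of_others// PDE.
have QlawT (A : 'I_n -> set R) (J : {set 'I_n}) :
    (forall i, measurable (A i)) -> k \notin J ->
  (Q (\bigcap_(i in [set` J]) (X i @^-1` A i)) =
   P (\bigcap_(i in [set` J]) (X i @^-1` A i)))%E.
  move=> mA kJ; rewrite -[X in Q X]setIT -(preimage_setT (X k)) Qlaw//.
  by rewrite unif1 mule1.
have Qother i A : i != k -> measurable A -> Q (X i @^-1` A) = P (X i @^-1` A).
  move=> ik mA; have := @QlawT (fun=> A) [set i]%SET.
  have -> : \bigcap_(j in [set` [set i]%SET]) (X j @^-1` A) = X i @^-1` A.
    apply/seteqP; split=> w /=; first by apply; rewrite /= finset.in_set1.
    by move=> wA j /=; rewrite finset.in_set1 => /eqP ->.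
  by apply => //; rewrite finset.in_set1 eq_sym.
have Qk A : measurable A -> Q (X k @^-1` A) =
    (\int[lebesgue_measure]_(x in A) (uniform_pdf (- r) r x)%:E)%E.
  move=> mA; have := @Qlaw (fun=> A) finset.set0 A (fun=> mA) mA.
  rewrite (_ : \bigcap_(i in _) _ = setT); last first.
    by apply/seteqP; split=> w // _ i /=; rewrite finset.in_set0.
  by rewrite setTI probability_setT mul1e; apply; rewrite finset.in_set0.
exists Q; split.
- move=> J A mA; have [kJ|kJ] := boolP (k \in J); last first.
    rewrite QlawT// indX//; apply: eq_bigr => i iJ; rewrite Qother//.
    by apply: contraNneq kJ => <-.
  rewrite (big_setD1 k)//= -{1}(finset.setD1K kJ) bigcap_preimage_setU1.
  rewrite Qlaw ?finset.setD11// indX// Qk// muleC; congr (_ * _)%E.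
  by apply: eq_bigr => i; rewrite finset.in_setD1 => /andP[ik _]; rewrite Qother.
- by move=> i ik A; exact: Qother.
- split.
  + exact: measurable_uniform_pdf.
  + by move=> x; exact: uniform_pdf_ge0.
  + exact: Qk.
- move=> E mE; rewrite QE.
  have mLX : measurable (level (f \o X k) s).
    by apply: measurable_level; apply: measurableT_comp => //; case: fX.
  rewrite -ge0_integralZl//; last 3 first.
  + exact/measurable_EFinP/measurable_funTS.
  + by move=> w _; rewrite lee_fin.
  + by rewrite lee_fin mulr_ge0// ltW.
  rewrite [LHS]integral_mkcond [RHS]integral_mkcond; apply: eq_integral => w _.
  rewrite !patchE /level_weight !indicE.
  have -> : (w \in level (f \o X k) s) = (X k w \in level f s).
    by apply/idP/idP; rewrite !inE.
  have r0 : r != 0 by rewrite gt_eqF.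
  case: ifPn => [|_].
    rewrite inE => /andP[s0 sx]; have fx0 : f (X k w) != 0 by rewrite gt_eqF// (lt_trans s0).
    case: ifPn => _; last by rewrite mulr0.
    by rewrite -EFinM; congr EFin; field; rewrite fx0 r0.
  by case: ifPn => _ //; rewrite mul0r mule0.
Qed.

End condition_coordinate.

(** * Mixtures of uniform laws *)

(** Layer cake for f (X w) against the weight 1 / f (X w) on E. The two factors
    cancel outside the event f (X w) = 0, which has probability 0. *)
Lemma probability_level_mixture d (T : measurableType d) (R : realType)
    (P : probability T R) (X : {RV P >-> R}) (f : R -> R) (E : set T) :
  has_density X f -> measurable E ->
  (P E = \int[lebesgue_measure]_s
     \int[P]_(w in level (f \o X) s) ((f (X w))^-1 * \1_E w)%:E)%E.
Proof.
move=> [mf f0 lawX] mE.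
have mfX : measurable_fun setT (f \o X) by exact: measurableT_comp.
have mfV : measurable_fun setT (fun w => ((f (X w))^-1 * \1_E w)%:E).
  apply/measurable_EFinP; apply: measurable_funM.
    by apply: measurableT_comp => //; exact: measurable_inv.
  exact: measurable_indic.
rewrite -layer_cake//; last 2 first.
- by move=> w; exact: f0.
- by move=> w; rewrite lee_fin mulr_ge0// invr_ge0.
pose Z : set R := f @^-1` [set 0].
have mZ : measurable Z by rewrite -[Z]setTI; exact: mf.
have PZ : P (X @^-1` Z) = 0%E.
  rewrite [LHS](lawX Z mZ); apply: integral0_eq => x; rewrite /Z/= => ->.
  by [].
have mXZ : measurable (X @^-1` Z) by rewrite -[_ @^-1` _]setTI; exact: measurable_funP.
rewrite -[E in LHS]setIT -integral_indic//.
rewrite (ge0_negligible_integral mXZ)//; last first.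
  by apply/measurable_EFinP; exact: measurable_indic.
rewrite [RHS](ge0_negligible_integral mXZ)//; last 2 first.
- by apply: emeasurable_funM => //; exact/measurable_EFinP.
- by move=> w _; apply: mule_ge0; rewrite lee_fin//= ?mulr_ge0// ?invr_ge0.
apply: eq_integral => w; rewrite inE => -[_ /= fw0].
by rewrite -EFinM mulrA divff ?mul1r//; apply/eqP.
Qed.

Section uniform_mixture.
Context d (T : measurableType d) (R : realType) (n : nat).
Variables (X : 'I_n -> {mfun T >-> R}) (E : set T) (mE : measurable E).
Variables (f : R -> R) (hf : symmetric_unimodal f).
Local Notation rad := (level_radius f).
Local Notation mu := (@lebesgue_measure R).
Variables (M2 Mi : R).
Hypothesis hM2 : (\int[mu]_s (2 * rad s * rad s ^+ 2)%:E <= M2%:E)%E.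
Hypothesis hMi : (\int[mu]_s (2 * rad s * rad s ^- 2)%:E <= Mi%:E)%E.
Variables (u v : 'I_n -> R).
Hypothesis (u0 : forall i, 0 <= u i) (v0 : forall i, 0 <= v i).

Hypothesis uniform_bound : forall (Q : probability T R) (rho : 'I_n -> R),
  (forall i, 0 < rho i) ->
  mutually_independent (X : 'I_n -> {RV Q >-> R}) ->
  (forall i, has_density (X i : {RV Q >-> R}) (uniform_pdf (- rho i) (rho i))) ->
  (Q E <= (\sum_i (u i * rho i ^+ 2 + v i * rho i ^- 2))%:E)%E.

Let rad_ge0 s : 0 <= 2 * rad s.
Proof. by rewrite mulr_ge0// level_radius_ge0. Qed.

Let M2_ge0 : 0 <= M2.
Proof.
rewrite -lee_fin; apply: le_trans hM2; apply: integral_ge0 => s _.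
by rewrite lee_fin mulr_ge0// exprn_ge0// level_radius_ge0.
Qed.

Let Mi_ge0 : 0 <= Mi.
Proof.
rewrite -lee_fin; apply: le_trans hMi; apply: integral_ge0 => s _.
by rewrite lee_fin mulr_ge0// invr_ge0 exprn_ge0// level_radius_ge0.
Qed.

(** The expectation of c + a r ^ 2 + b r ^ -2 over the random radius r. *)
Lemma integral_level_bound (c a b : R) :
  measurable_fun setT f -> (forall x, 0 <= f x) ->
  (\int[mu]_x (f x)%:E = 1)%E -> 0 <= c -> 0 <= a -> 0 <= b ->
  (\int[mu]_s ((2 * rad s)%:E * (c + (a * rad s ^+ 2 + b * rad s ^- 2))%:E)
   <= (c + (a * M2 + b * Mi))%:E)%E.
Proof.
move=> mf f0 f1 c0 a0 b0.
have mr := measurable_level_radius mf.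
have m2r : measurable_fun [set: R] (fun s => 2 * rad s) by exact: measurable_funM.
have m1 : measurable_fun [set: measurableTypeR R] (fun s => (2 * rad s)%:E : \bar R).
  exact/measurable_EFinP.
have m2 : measurable_fun [set: measurableTypeR R]
    (fun s => (2 * rad s * rad s ^+ 2)%:E : \bar R).
  by apply/measurable_EFinP; apply: measurable_funM => //; exact: measurable_funX.
have m3 : measurable_fun [set: measurableTypeR R]
    (fun s => (2 * rad s * rad s ^- 2)%:E : \bar R).
  apply/measurable_EFinP; apply: measurable_funM => //.
  by apply: measurableT_comp; [exact: measurable_inv|exact: measurable_funX].
have p1 s : (0 <= (2 * rad s)%:E)%E by rewrite lee_fin.
have p2 s : (0 <= (2 * rad s * rad s ^+ 2)%:E)%E.
  by rewrite lee_fin mulr_ge0// exprn_ge0// level_radius_ge0.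
have p3 s : (0 <= (2 * rad s * rad s ^- 2)%:E)%E.
  by rewrite lee_fin mulr_ge0// invr_ge0 exprn_ge0// level_radius_ge0.
have -> : (\int[mu]_s ((2 * rad s)%:E * (c + (a * rad s ^+ 2 + b * rad s ^- 2))%:E) =
  \int[mu]_s (c%:E * (2 * rad s)%:E +
   (a%:E * (2 * rad s * rad s ^+ 2)%:E + b%:E * (2 * rad s * rad s ^- 2)%:E)))%E.
  by apply: eq_integral => s _; rewrite -!EFinM -!EFinD; congr EFin; ring.
rewrite ge0_integralD//; last 4 first.
- by move=> s _; rewrite mule_ge0.
- exact: emeasurable_funM.
- by move=> s _; rewrite adde_ge0// mule_ge0.
- by apply: emeasurable_funD; exact: emeasurable_funM.
rewrite ge0_integralD//; last 4 first.
- by move=> s _; rewrite mule_ge0.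
- exact: emeasurable_funM.
- by move=> s _; rewrite mule_ge0.
- exact: emeasurable_funM.
rewrite !ge0_integralZl// (integral_level_radius mf f0 f1) mule1.
by rewrite !EFinD !EFinM leeD// leeD// lee_wpmul2l.
Qed.

(** Bounds that are affine in each rho_i ^ 2 and rho_i ^ -2 pass from uniform
    laws to the mixture f, each moment of the radius being replaced by its
    expectation. The set K of coordinates that still have density f shrinks by
    one at each step of the induction. *)
Lemma uniform_mixture_bound (K : {set 'I_n}) (P : probability T R) (rho : 'I_n -> R) :
  (forall i, 0 < rho i) ->
  mutually_independent (X : 'I_n -> {RV P >-> R}) ->
  (forall i, has_density (X i : {RV P >-> R})
     (if i \in K then f else uniform_pdf (- rho i) (rho i))) ->
  (P E <= (\sum_i (if i \in K then u i * M2 + v i * Mi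
                   else u i * rho i ^+ 2 + v i * rho i ^- 2))%:E)%E.
Proof.
elim: {K}#|K| {-2}K (erefl #|K|) P rho => [|m IH] K cK P rho rho0 indX lawX.
  move/eqP: cK; rewrite cards_eq0 => /eqP K0; rewrite {K}K0 in lawX *.
  under eq_bigr do rewrite finset.in_set0.
  by apply: uniform_bound => // i; have := lawX i; rewrite finset.in_set0.
have [k kK] : exists k, k \in K by apply/set0Pn; rewrite -cards_eq0 cK.
have fX : has_density (X k : {RV P >-> R}) f by have := lawX k; rewrite kK.
have [mf f0 _] := fX; have f1 := has_density_integral1 fX.
pose term i := if i \in K then u i * M2 + v i * Mi
               else u i * rho i ^+ 2 + v i * rho i ^- 2.
pose c := \sum_(i | i != k) term i.
have c0 : 0 <= c.
  apply: sumr_ge0 => i _; rewrite /term; case: ifP => _.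
    by rewrite addr_ge0// mulr_ge0.
  by rewrite addr_ge0// mulr_ge0// ?invr_ge0 exprn_ge0// ltW.
rewrite (bigD1 k)//= kK -/c addrC.
rewrite (@probability_level_mixture _ _ _ P (X k) f)//.
apply: le_trans (integral_level_bound mf f0 f1 c0 (u0 k) (v0 k)).
have mfV : measurable_fun setT (fun w => ((f (X k w))^-1 * \1_E w)%:E).
  apply/measurable_EFinP; apply: measurable_funM; last exact: measurable_indic.
  apply: measurableT_comp; first exact: measurable_inv.
  exact: measurableT_comp.
have fV0 w : (0 <= ((f (X k w))^-1 * \1_E w)%:E)%E.
  by rewrite lee_fin mulr_ge0// invr_ge0.
have mfX : measurable_fun setT (f \o X k) by exact: measurableT_comp.
apply: ge0_le_integral => //.
- by move=> s _; exact: integral_ge0.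
- exact: measurable_level_integral.
- apply/measurable_EFinP; have mr := measurable_level_radius mf.
  have mr2 : measurable_fun [set: R] (fun s => rad s ^+ 2) by exact: measurable_funX.
  apply: measurable_funM; first exact: measurable_funM.
  apply: measurable_funD => //; apply: measurable_funD; first exact: measurable_funM.
  apply: measurable_funM => //.
  by apply: measurableT_comp; first exact: measurable_inv.
move=> s _.
have := level_radius_ge0 f s; rewrite le_eqVlt => /predU1P[r0|r0].
  (* A level set of radius 0 need not be empty, but it is negligible. *)
  rewrite -r0 mulr0 mul0e.
  have PL0 : P (level (f \o X k) s) = 0%E.
    have mL := measurable_level mf s.
    have [_ _ lawXk] := fX.
    rewrite [LHS](lawXk _ mL); apply: null_set_integral => //.
      by apply/measurable_EFinP/measurable_funTS.
    by rewrite /= (level_measureE mf f0 f1) -r0 mulr0.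
  have mLX := measurable_level mfX s.
  rewrite null_set_integral//; exact: measurable_funTS.
have [Q [indQ otherQ lawQ intQ]] := condition_on_level indX fX hf r0.
have rad2_gt0 : 0 < 2 * rad s by rewrite mulr_gt0.
rewrite intQ// lee_pmul2l ?lte_fin//.
pose rho' i := if i == k then rad s else rho i.
apply: (le_trans (IH (K :\ k)%SET _ Q rho' _ indQ _)).
- by move: cK; rewrite (cardsD1 k) kK add1n => -[].
- by move=> i; rewrite /rho'; case: ifP.
- move=> i; rewrite finset.in_setD1 /rho'; have [->//|ik/=] := eqVneq i k.
  have [mg g0 lawg] := lawX i.
  by split => // A mA; rewrite -lawg//; exact: otherQ.
rewrite lee_fin (bigD1 k)//= finset.setD11 /rho' eqxx addrC lerD2r.
apply: ler_sum => i ik; rewrite finset.in_setD1 ik/= /term.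
by rewrite (negbTE ik).
Qed.

End uniform_mixture.

(** * The comparison for uniform laws *)

Section rescale.
Context d (T : measurableType d) (R : realType).

Definition rescale (X : {mfun T >-> R}) (a : R) (w : T) : R := X w / a.

Let measurable_rescale X a : measurable_fun setT (rescale X a).
Proof. exact: measurable_funM. Qed.

HB.instance Definition _ X a :=
  isMeasurableFun.Build _ _ _ _ (rescale X a) (measurable_rescale X a).

Lemma has_density_rescale (P : probability T R) (X : {RV P >-> R}) (a : R) :
  0 < a -> has_density X (uniform_pdf (- a) a) ->
  has_density (rescale X a : {RV P >-> R}) (uniform_pdf (-1) 1).
Proof.
move=> a0 [_ _ lawX]; split.
- exact: measurable_uniform_pdf.
- by move=> x; apply: uniform_pdf_ge0; lra.
move=> A mA.
have mdiv : measurable_fun setT (fun x : R => x / a) by exact: measurable_funM.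
pose A' := (fun x : R => x / a) @^-1` A.
have mA' : measurable A' by rewrite -[A']setTI; exact: mdiv.
transitivity (distribution P X A'); first by [].
have unifE (b : R) (D : set R) : 0 < b -> measurable D ->
    (\int[lebesgue_measure]_(x in D) (uniform_pdf (- b) b x)%:E =
     ((2 * b)^-1)%:E * lebesgue_measure (D `&` `[(- b)%R, b]))%E.
  move=> b0 mD; rewrite integral_uniform_pdf.
  rewrite (eq_integral (fun=> ((2 * b)^-1)%:E)).
    by rewrite integral_cst//; exact: measurableI.
  move=> x; rewrite inE => -[_]; rewrite /= in_itv/= /uniform_pdf => ->.
  by rewrite opprK; congr ((_)^-1)%:E; lra.
rewrite lawX// !unifE//.
have -> : A' `&` `[- a, a] = [set x | (A `&` `[-1, 1]) (x / a)].
  apply/seteqP; split=> x /=; rewrite !in_itv/= ler_pdivlMr// ler_pdivrMr//;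
  by rewrite mulN1r mul1r.
rewrite lebesgue_measure_div//; last exact: measurableI.
rewrite muleA -EFinM; congr (_%:E * _)%E; rewrite mulr1.
by field; rewrite gt_eqF.
Qed.

Lemma mutually_independent_rescale (P : probability T R) n
    (X : 'I_n -> {RV P >-> R}) (a : 'I_n -> R) :
  mutually_independent X ->
  mutually_independent (fun i => rescale (X i) (a i) : {RV P >-> R}).
Proof.
move=> indX J A mA.
have mdiv i : measurable_fun setT (fun x : R => x / a i) by exact: measurable_funM.
apply: (indX J (fun i => (fun x : R => x / a i) @^-1` A i)) => i.
by rewrite -[_ @^-1` _]setTI; exact: mdiv.
Qed.

Lemma has_density_nondegenerate (P : probability T R) (X : {RV P >-> R}) (f : R -> R) :
  has_density X f -> Defs.nondegenerate X.
Proof.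
move=> [_ _ lawX] [c]; have := lawX [set c] (measurable_set1 c).
rewrite integral_set1 => h; rewrite [X in X = _ -> _](_ : _ = distribution P X [set c])//.
by rewrite h => /eqP; rewrite eqe eq_sym oner_eq0.
Qed.

End rescale.

Section uniform_log_concave.
Context (R : realType).

(** The convex function is ln 2 on [-1, 1] and infinite elsewhere. *)
Lemma log_concave_uniform_pdf : log_concave (uniform_pdf (-1) 1 : R -> R).
Proof.
exists (fun x : R => if -1 <= x <= 1 then (ln 2)%:E else +oo%E); split; last first.
  move=> x; rewrite /uniform_pdf; case: ifP => _ //=.
  by rewrite expRN lnK ?posrE//; congr (_^-1)%:E; lra.
split=> [x|x y t /andP[t0 t1]]; first by case: ifP.
have s0 : 0 < 1 - t by lra.
have ty (b : R) : 0 < b -> (b%:E * +oo = +oo)%E by move=> b0; rewrite gt0_muley ?lte_fin.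
case: (boolP (-1 <= x <= 1)) => xin; last first.
  rewrite ty//; case: (boolP (-1 <= y <= 1)) => _; first by rewrite -EFinM addye ?leey.
  by rewrite ty// leey.
case: (boolP (-1 <= y <= 1)) => yin; last by rewrite ty// -EFinM addey ?leey.
have -> : -1 <= t * x + (1 - t) * y <= 1.
  move: xin yin => /andP[x1 x2] /andP[y1 y2]; apply/andP; split; nra.
by rewrite -!EFinM -EFinD lee_fin; lra.
Qed.

Lemma symmetric_uniform_pdf : symmetric_density (uniform_pdf (-1) 1 : R -> R).
Proof.
by move=> x; rewrite /uniform_pdf lerN2 lerNl andbC.
Qed.

End uniform_log_concave.

Section log_concave_bound.
Context (R : realType) (C : R) (hC : log_concave_constant C).

(** Dividing X_i by rho_i makes the variables identically distributed, and
    multiplying the coefficients by rho_i restores the original event. *)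
Lemma uniform_comparison n (hn : (0 < n)%N) d (T : measurableType d) (P : probability T R)
  (X : 'I_n -> {RV P >-> R}) (rho : 'I_n -> R) (alpha beta : 'rV[R]_n) :
  (forall i, 0 < rho i) -> mutually_independent X ->
  (forall i, has_density (X i) (uniform_pdf (- rho i) (rho i))) -> alpha != 0 ->
  (P [set w | `|inner alpha X w| <= `|inner beta X w| ]%R <=
   (C * (euclidean_norm (\row_i (beta 0 i * rho i)) /
         euclidean_norm (\row_i (alpha 0 i * rho i))))%:E)%E.
Proof.
move=> rho0 indX lawX a0.
pose Z i : {RV P >-> R} := rescale (X i) (rho i).
have lawZ i : has_density (Z i) (uniform_pdf (-1) 1) by exact: has_density_rescale.
have innerE (a : 'rV[R]_n) w : inner (\row_i (a 0 i * rho i)) Z w = inner a X w.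
  apply: eq_bigr => i _; rewrite mxE /Z/= /rescale.
  by field; rewrite gt_eqF.
have := @hC n hn d T P Z _ _ (fun i => has_density_nondegenerate (lawZ i))
  (log_concave_uniform_pdf R) (@symmetric_uniform_pdf R)
  (\row_i (alpha 0 i * rho i)) (\row_i (beta 0 i * rho i)).
under eq_set do rewrite !innerE.
apply; first by split=> //; exact: mutually_independent_rescale.
apply: contra_neq a0 => /rowP a0; apply/rowP => i; have := a0 i; rewrite !mxE.
by move/eqP; rewrite mulf_eq0 (gt_eqF (rho0 i)) orbF => /eqP.
Qed.

(** For a single variable and alpha = beta the probability is nonnegative and
    the ratio of norms is 1. *)
Lemma log_concave_constant_ge0 : 0 <= C.
Proof.
have ab : (-1 < 1 :> R) by lra.
pose P : probability (measurableTypeR R) R := uniform_prob ab.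
pose idR : {RV P >-> R} := HB.pack (idfun : measurableTypeR R -> R)
  (@isMeasurableFun.Build _ _ (measurableTypeR R) R idfun (@measurable_id _ _ setT)).
pose X (i : 'I_1) : {RV P >-> R} := idR.
have indX : mutually_independent X.
  move=> J A mA; have [J0|] := eqVneq J finset.set0.
    rewrite J0 big_set0 (_ : \bigcap_(i in _) _ = setT) ?probability_setT//.
    by apply/seteqP; split=> w // _ i /=; rewrite finset.in_set0.
  case/set0Pn => i iJ; have -> : J = [set i]%SET.
    by apply/setP => j; rewrite finset.in_set1 (ord1 i) (ord1 j) eqxx -(ord1 i).
  rewrite big_set1; congr (P _); apply/seteqP; split=> w /=.
    by apply; rewrite /= finset.in_set1.
  by move=> wA j /=; rewrite finset.in_set1 => /eqP ->.
have lawX i : has_density (X i) (uniform_pdf (- 1) 1).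
  by split=> //; [exact: measurable_uniform_pdf|move=> x; exact: uniform_pdf_ge0].
have := @uniform_comparison 1 isT _ _ P X (fun=> 1) (const_mx 1) (const_mx 1)
  (fun=> ltr01) indX lawX.
have c0 : const_mx 1 != 0 :> 'rV[R]_1.
  by apply/eqP => /rowP/(_ 0); rewrite !mxE => /eqP; rewrite oner_eq0.
move/(_ c0)/(le_trans (measure_ge0 _ _)); rewrite lee_fin.
rewrite divff ?mulr1// /euclidean_norm big_ord1 !mxE mul1r expr1n sqrtr1.
exact: oner_neq0.
Qed.

End log_concave_bound.

Section euclidean_ratio.
Context (R : realType) (n : nat).
Implicit Types (a b : 'rV[R]_n).

Lemma euclidean_norm_sqr a : euclidean_norm a ^+ 2 = \sum_i a 0 i ^+ 2.
Proof. by rewrite sqr_sqrtr// sumr_ge0// => i _; rewrite sqr_ge0. Qed.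

Lemma euclidean_norm_gt0 a : a != 0 -> 0 < euclidean_norm a.
Proof.
move=> a0; rewrite sqrtr_gt0 lt0r sumr_ge0 ?andbT => [|i _]; last exact: sqr_ge0.
apply: contra_neq a0 => /eqP; rewrite psumr_eq0 => [/allP h|i _]; last exact: sqr_ge0.
apply/rowP => i; rewrite mxE; apply/eqP; rewrite -sqrf_eq0.
exact: (h i (mem_index_enum _)).
Qed.

(** Let sb be the average of the rho_i ^ 2 with weights b_i ^ 2 / |b| ^ 2, and sa
    that of the rho_i ^ -2 with weights a_i ^ 2 / |a| ^ 2. The square of the
    left-hand side is (|b| / |a|) ^ 2 * sb divided by the a-average of the
    rho_i ^ 2, and Jensen bounds the inverse of that average by sa. It remains
    to use sqrt (sb * sa) <= (sb + sa) / 2. *)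
Lemma euclidean_ratio_le a b (rho : 'I_n -> R) :
  (forall i, 0 < rho i) -> a != 0 ->
  euclidean_norm (\row_i (b 0 i * rho i)) / euclidean_norm (\row_i (a 0 i * rho i)) <=
  euclidean_norm b / euclidean_norm a / 2 *
  \sum_i (b 0 i ^+ 2 / euclidean_norm b ^+ 2 * rho i ^+ 2 +
          a 0 i ^+ 2 / euclidean_norm a ^+ 2 * rho i ^- 2).
Proof.
move=> rho0 a0; have na0 := euclidean_norm_gt0 a0.
have [->|b0] := eqVneq b 0.
  have -> : euclidean_norm (0 : 'rV[R]_n) = 0.
    by rewrite /euclidean_norm big1 ?sqrtr0// => i _; rewrite mxE expr0n.
  rewrite [X in X / _](_ : _ = 0) ?mul0r//.
  by rewrite /euclidean_norm big1 ?sqrtr0// => i _; rewrite !mxE mul0r expr0n.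
have nb0 := euclidean_norm_gt0 b0.
have ra0 : 0 < euclidean_norm (\row_i (a 0 i * rho i)).
  apply: euclidean_norm_gt0; apply: contra_neq a0 => /rowP a0; apply/rowP => i.
  have := a0 i; rewrite !mxE => /eqP.
  by rewrite mulf_eq0 (gt_eqF (rho0 i)) orbF => /eqP.
set ra := euclidean_norm (\row_i (a 0 i * rho i)) in ra0 *.
set rb := euclidean_norm (\row_i (b 0 i * rho i)).
set na := euclidean_norm a in na0 *; set nb := euclidean_norm b in nb0 *.
rewrite big_split/=.
set sb := \sum_i _; set sa := \sum_i _.
have sb0 : 0 <= sb.
  by apply: sumr_ge0 => i _; rewrite mulr_ge0 ?sqr_ge0// divr_ge0 ?sqr_ge0.
have rbE : rb ^+ 2 = nb ^+ 2 * sb.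
  rewrite euclidean_norm_sqr mulr_sumr; apply: eq_bigr => i _; rewrite mxE.
  by field; rewrite gt_eqF.
have sa_ge : (na / ra) ^+ 2 <= sa.
  (* Jensen: with t the average of the rho_i ^ 2, average the tangent inequality
     1 / y >= 2 / t - y / t ^ 2 over y = rho_i ^ 2. *)
  pose t := (ra / na) ^+ 2.
  have t0 : 0 < t by rewrite exprn_gt0// divr_gt0.
  have -> : (na / ra) ^+ 2 = \sum_i (a 0 i ^+ 2 / na ^+ 2 * (2 / t) -
      (a 0 i * rho i) ^+ 2 / (na ^+ 2 * t ^+ 2)).
    rewrite sumrB -!mulr_suml -euclidean_norm_sqr -/na.
    have -> : \sum_i (a 0 i * rho i) ^+ 2 = ra ^+ 2.
      by rewrite euclidean_norm_sqr; apply: eq_bigr => i _; rewrite mxE.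
    by rewrite /t; field; rewrite !gt_eqF.
  apply: ler_sum => i _.
  have -> : (a 0 i * rho i) ^+ 2 / (na ^+ 2 * t ^+ 2) =
            a 0 i ^+ 2 / na ^+ 2 * (rho i ^+ 2 / t ^+ 2).
    by field; rewrite !gt_eqF.
  rewrite -mulrBr ler_wpM2l// ?divr_ge0 ?sqr_ge0//.
  rewrite -subr_ge0.
  have -> : rho i ^- 2 - (2 / t - rho i ^+ 2 / t ^+ 2) = ((rho i)^-1 - rho i / t) ^+ 2.
    by field; rewrite !gt_eqF.
  exact: sqr_ge0.
have sa0 : 0 <= sa by apply: le_trans sa_ge; rewrite sqr_ge0.
rewrite -(@ler_pXn2r _ 2)//; last 2 first.
- by rewrite nnegrE divr_ge0 ?sqrtr_ge0.
- by rewrite nnegrE !mulr_ge0 ?invr_ge0 ?addr_ge0// ltW.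
have -> : (rb / ra) ^+ 2 = (nb / na) ^+ 2 * (sb * (na / ra) ^+ 2).
  by rewrite expr_div_n rbE; field; rewrite !gt_eqF.
have -> : (nb / na / 2 * (sb + sa)) ^+ 2 = (nb / na) ^+ 2 * (2^-1 * (sb + sa)) ^+ 2.
  by field; rewrite gt_eqF.
rewrite ler_wpM2l ?sqr_ge0//.
apply: (le_trans (ler_wpM2l sb0 sa_ge)).
rewrite -subr_ge0.
have -> : (2^-1 * (sb + sa)) ^+ 2 - sb * sa = ((sb - sa) / 2) ^+ 2 by field.
exact: sqr_ge0.
Qed.

End euclidean_ratio.

(** * The bound for symmetric unimodal densities *)

(** Pointwise, r ^ 2 + r ^ -2 >= 2. *)
Lemma level_moments_ge2 (R : realType) (f : R -> R) (M2 Mi : R) :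
  measurable_fun setT f -> (forall x, 0 <= f x) ->
  (\int[lebesgue_measure]_x (f x)%:E = 1)%E ->
  (\int[lebesgue_measure]_s (2 * level_radius f s * level_radius f s ^+ 2)%:E <= M2%:E)%E ->
  (\int[lebesgue_measure]_s (2 * level_radius f s * level_radius f s ^- 2)%:E <= Mi%:E)%E ->
  2 <= M2 + Mi.
Proof.
move=> mf f0 f1 hM2 hMi; rewrite -lee_fin EFinD.
apply: le_trans (leeD hM2 hMi).
have mr := measurable_level_radius mf.
have m2r : measurable_fun [set: R] (fun s => 2 * level_radius f s).
  exact: measurable_funM.
have r0 s := level_radius_ge0 f s.
have m2 : measurable_fun [set: measurableTypeR R]
    (fun s => (2 * level_radius f s * level_radius f s ^+ 2)%:E : \bar R).
  by apply/measurable_EFinP; apply: measurable_funM => //; exact: measurable_funX.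
have m3 : measurable_fun [set: measurableTypeR R]
    (fun s => (2 * level_radius f s * level_radius f s ^- 2)%:E : \bar R).
  apply/measurable_EFinP; apply: measurable_funM => //.
  by apply: measurableT_comp; [exact: measurable_inv|exact: measurable_funX].
have m1 : measurable_fun [set: measurableTypeR R]
    (fun s => (2 * level_radius f s)%:E : \bar R).
  exact/measurable_EFinP.
have p1 s : (0 <= (2 * level_radius f s)%:E)%E by rewrite lee_fin mulr_ge0.
have p2 s : (0 <= (2 * level_radius f s * level_radius f s ^+ 2)%:E)%E.
  by rewrite EFinM mule_ge0// lee_fin exprn_ge0.
have p3 s : (0 <= (2 * level_radius f s * level_radius f s ^- 2)%:E)%E.
  by rewrite EFinM mule_ge0// lee_fin invr_ge0 exprn_ge0.
apply: (@le_trans _ _ (\int[lebesgue_measure]_s (2%:E * (2 * level_radius f s)%:E))%E).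
  by rewrite ge0_integralZl// (integral_level_radius mf f0 f1) mule1.
rewrite -ge0_integralD//; apply: ge0_le_integral => //.
- by move=> s _; rewrite mule_ge0.
- exact: emeasurable_funM.
- exact: emeasurable_funD.
move=> s _; rewrite -EFinM -EFinD lee_fin.
have := r0 s; rewrite le_eqVlt => /predU1P[<-|rs0].
  by rewrite !(mulr0, mul0r) addr0.
rewrite -mulrDr mulrC ler_wpM2l//; first by rewrite mulr_ge0.
rewrite -subr_ge0.
have -> : level_radius f s ^+ 2 + level_radius f s ^- 2 - 2 =
    (level_radius f s - (level_radius f s)^-1) ^+ 2.
  by field; rewrite gt_eqF.
exact: sqr_ge0.
Qed.

Theorem corollary5 (R : realType) (C : R) (hC : log_concave_constant C)
  (n : nat) (hn : (0 < n)%N)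
  (d : measure_display) (T : measurableType d) (P : probability T R)
  (X : 'I_n -> {RV P >-> R}) (f : R -> R)
  (hX : iid_with_density X f) (hf : symmetric_unimodal f)
  (B : R)
  (hB2 : (\int[lebesgue_measure]_t (t ^+ 2 * f t)%:E <= B%:E)%E)
  (hB3 : (\int[lebesgue_measure]_(t in `]0%R, 1%R])
            ((t ^- 3)%:E *
             (P [set w | `|X (Ordinal hn) w| <= t ]%R - (2 * t * f t)%:E))
          <= B%:E)%E)
  (alpha beta : 'rV[R]_n) (halpha : alpha != 0) :
  (P [set w | `|inner alpha X w| <= `|inner beta X w| ]%R <=
   (12 * C * B * (euclidean_norm beta / euclidean_norm alpha))%:E)%E.
Proof.
have [indX lawX] := hX.
have [mf f0 lawX0] := lawX (Ordinal hn); have f1 := has_density_integral1 (lawX (Ordinal hn)).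
have C0 := log_concave_constant_ge0 hC.
have hM2 : (\int[lebesgue_measure]_s
    (2 * level_radius f s * level_radius f s ^+ 2)%:E <= (3 * B)%:E)%E.
  by rewrite integral_level_radius_sqr// EFinM lee_wpmul2l.
have hMi : (\int[lebesgue_measure]_s
    (2 * level_radius f s * level_radius f s ^- 2)%:E <= (2 * B + 1)%:E)%E.
  apply: integral_level_radius_inv_sqr => //; apply: le_trans hB3.
  rewrite le_eqVlt; apply/orP; left; apply/eqP; apply: eq_integral => t _.
  congr (_ * (_ - _))%E; rewrite -lawX0//; congr (P _).
  by apply/seteqP; split=> w /=; rewrite in_itv/= ler_norml.
have B5 : 1 <= 5 * B by have := level_moments_ge2 mf f0 f1 hM2 hMi; lra.
(* The weights q vanish for b = 0, hence they sum to 1 or to 0. *)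
pose q (b : 'rV[R]_n) i := b 0 i ^+ 2 / euclidean_norm b ^+ 2.
have q0 b i : 0 <= q b i by rewrite divr_ge0 ?sqr_ge0.
have sumq b : \sum_i q b i <= 1.
  rewrite -mulr_suml -euclidean_norm_sqr.
  have [->|nb0] := eqVneq (euclidean_norm b ^+ 2) 0; first by rewrite mul0r.
  by rewrite divff.
pose c := euclidean_norm beta / euclidean_norm alpha.
have c0 : 0 <= c by rewrite divr_ge0 ?sqrtr_ge0.
have D0 : 0 <= C * (c / 2) by rewrite mulr_ge0// divr_ge0.
pose u i := C * (c / 2) * q beta i; pose v i := C * (c / 2) * q alpha i.
have u0 i : 0 <= u i by rewrite mulr_ge0.
have v0 i : 0 <= v i by rewrite mulr_ge0.
have minner (a : 'rV[R]_n) : measurable_fun setT (inner a X).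
  by apply: measurable_sum => i; exact: measurable_funM.
have mE : measurable [set w | `|inner alpha X w| <= `|inner beta X w|].
  rewrite -[X in measurable X]setTI.
  have : measurable_fun setT (fun w => `|inner alpha X w| <= `|inner beta X w|).
    by apply: measurable_fun_ler; apply: measurableT_comp.
  by move=> /(_ measurableT [set true]); apply.
have uniform_bound (Q : probability T R) (rho : 'I_n -> R) :
    (forall i, 0 < rho i) ->
    mutually_independent (X : 'I_n -> {RV Q >-> R}) ->
    (forall i, has_density (X i : {RV Q >-> R}) (uniform_pdf (- rho i) (rho i))) ->
    (Q [set w | `|inner alpha X w| <= `|inner beta X w| ]%R <=
     (\sum_i (u i * rho i ^+ 2 + v i * rho i ^- 2))%:E)%E.
  move=> rho0 indQ lawQ.
  apply: le_trans (uniform_comparison hC hn beta rho0 indQ lawQ halpha) _.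
  rewrite lee_fin.
  have -> : \sum_i (u i * rho i ^+ 2 + v i * rho i ^- 2) =
      C * (c / 2 * \sum_i (q beta i * rho i ^+ 2 + q alpha i * rho i ^- 2)).
    rewrite mulrA mulr_sumr; apply: eq_bigr => i _; rewrite /u /v; ring.
  by rewrite ler_wpM2l// euclidean_ratio_le.
(* No coordinate has been conditioned yet, so the radii are dummies. *)
have lawT i : has_density (X i)
    (if i \in [set: 'I_n]%SET then f else uniform_pdf (- 1) 1).
  by rewrite finset.in_setT.
apply: le_trans (uniform_mixture_bound mE hf hM2 hMi u0 v0 uniform_bound
  (rho := fun=> 1) (fun=> ltr01) indX lawT) _.
rewrite lee_fin.
under eq_bigr do rewrite finset.in_setT.
rewrite big_split/= -!mulr_suml -!mulr_sumr -/c.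
have [B0 Cc] : 0 <= B /\ 0 <= C * c by split; [lra|exact: mulr_ge0].
have sumq_le b m : 0 <= m -> C * (c / 2) * (\sum_i q b i) * m <= C * (c / 2) * m.
  by move=> m0; rewrite ler_wpM2r// -[leRHS]mulr1 ler_wpM2l.
have M2_ge0 : 0 <= 3 * B by rewrite mulr_ge0.
have Mi_ge0 : 0 <= 2 * B + 1 by rewrite addr_ge0// mulr_ge0.
apply: (le_trans (lerD (sumq_le beta _ M2_ge0) (sumq_le alpha _ Mi_ge0))).
have -> : C * (c / 2) * (3 * B) + C * (c / 2) * (2 * B + 1) = C * c * ((5 * B + 1) / 2) by field.
have -> : 12 * C * B * c = C * c * (12 * B) by ring.
by rewrite ler_wpM2l//; lra.
Qed.
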